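(* \[ \liminf_{n\to \infty} \frac{\phi^*(\phi^*(n))}{\log n \log \log n}> 0. \]
   Context: $\phi^*$ is the unitary Euler function: the multiplicative function with $\phi^*(1)=1$ and, if $n=p_1^{a_1}\cdots p_r^{a_r}$ is the prime factorization of $n>1$, $\phi^*(n)=(p_1^{a_1}-1)\cdots(p_r^{a_r}-1)$. *)

(* Defs.v *)
From mathcomp Require Import all_boot.

Set Implicit Arguments.
Unset Strict Implicit.
Unset Printing Implicit Defensive.

(* The unitary Euler function phi^* on positive integers: [logn p n] is the
   exact exponent of [p] in [n], and each factor is at least 1, so the
   subtraction never truncates.  [primes] is empty at 0 and 1, so the value is
   1 at n = 1, and a junk value 1 at n = 0. *)
Definition uphi (n : nat) : nat := \prod_(p <- primes n) (p ^ logn p n - 1).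

(* Main.v *)
Require Import Defs.
From mathcomp Require Import all_boot all_order all_algebra.
From mathcomp Require Import all_classical all_reals all_analysis.
From mathcomp Require Import zify ring lra.

(* Since q <= (q - 1)^2 for every integer q >= 3, and 2 = 2 (2 - 1)^2, one has
   n <= 2 phi^*(n)^2.  Iterating, n <= 8 N^4 with N = phi^*(phi^*(n)), so N
   grows at least like n^(1/4), far faster than log n log log n. *)

Import Order.TTheory GRing.Theory Num.Theory.

Local Open Scope ring_scope.

Lemma uphi_gt0 n : (0 < uphi n)%N.
Proof.
rewrite /uphi big_seq_cond; apply: prodn_cond_gt0 => p.
rewrite andbT mem_primes => /and3P[p_pr n_gt0 p_dvd_n].
rewrite subn_gt0 -[1%N](expn0 p) ltn_exp2l ?prime_gt1 //.
by rewrite logn_gt0 mem_primes p_pr n_gt0.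
Qed.

Lemma leq_uphi_sqr n : (n <= 2 * uphi n ^ 2)%N.
Proof.
case: (posnP n) => [->//|n_gt0].
rewrite {1}[n]prod_prime_decomp // prime_decompE big_map /=.
(* The prime 2 receives the extra factor 2 whatever its exponent, although only $q = 2$ needs it. It
   occurs at most once in [primes n], so these factors multiply to at most 2. *)
have le_factor : (\prod_(p <- primes n) p ^ logn p n <=
    \prod_(p <- primes n) (2 ^ (p == 2) * (p ^ logn p n - 1) ^ 2))%N.
  rewrite big_seq_cond [leqRHS]big_seq_cond; apply: leq_prod => p.
  rewrite andbT => p_in; have := p_in; rewrite mem_primes => /and3P[p_pr _ _].
  (* This excludes $q = 0$ and, for odd [p], gives $q \ge 3$, where $q \le (q-1)^2$ holds. *)
  have le_pq : (p <= p ^ logn p n)%N.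
    by rewrite -[leqLHS]expn1 leq_exp2l ?prime_gt1 // logn_gt0.
  have := prime_gt1 p_pr; move: (p ^ logn p n)%N le_pq => q.
  case: q => [|r] le_pr p_gt1; first by lia.
  by rewrite subn1 /= -mulnn; case: eqP => [p2|]; rewrite ?expn1 ?expn0; nia.
apply: leq_trans le_factor _; rewrite big_split /= -expn_sum.
have -> : (\prod_(p <- primes n) (p ^ logn p n - 1) ^ 2 = uphi n ^ 2)%N.
  by rewrite (big_morph (expn^~ 2) (fun x y => expnMn x y 2) (exp1n 2)).
rewrite leq_mul2r; apply/orP; right.
have -> : (\sum_(p <- primes n) (p == 2) = count_mem 2 (primes n))%N.
  by rewrite -sum1_count [RHS]big_mkcond; apply: eq_bigr => p _ /=; case: eqP.
by rewrite count_uniq_mem ?primes_uniq //; case: (_ \in _).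
Qed.

Lemma leq_uphi_uphi_expn4 n : (n <= 8 * uphi (uphi n) ^ 4)%N.
Proof.
have := leq_uphi_sqr n; have := leq_uphi_sqr (uphi n).
set m := uphi n; set k := uphi m => le_m le_n.
apply: leq_trans le_n _.
have -> : (8 * k ^ 4 = 2 * (2 * k ^ 2) ^ 2)%N by ring.
by rewrite leq_mul2l leq_exp2r.
Qed.

(** With $s = \sqrt N$, the quartic bound gives $n \le (2s)^8$, and $\ln x < x$ at $x = 2s$ gives
    $\ln n \le 16 s$. Working with $\sqrt N$ makes the squared bound linear in $N$. *)
Lemma ln_sqr_le_uphi_uphi (R : realType) (n : nat) : (0 < n)%N ->
  ln (n%:R : R) ^+ 2 <= 256 * (uphi (uphi n))%:R.
Proof.
move=> n_gt0; set N := uphi (uphi n).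
have N_ge1 : 1 <= N%:R :> R by rewrite ler1n uphi_gt0.
pose s := Num.sqrt (N%:R : R).
have s2 : s ^+ 2 = N%:R by rewrite sqr_sqrtr ?ler0n.
have s_gt0 : 0 < s by rewrite sqrtr_gt0; lra.
have nR_gt0 : 0 < n%:R :> R by rewrite ltr0n.
have le_n : n%:R <= (2 * s) ^+ 8 :> R.
  apply: (@le_trans _ _ (8 * N%:R ^+ 4)).
    by rewrite -natrX -natrM ler_nat leq_uphi_uphi_expn4.
  (* Here $(2s)^8 = 2^8 N^4$, so only $8 \le 2^8$ remains. *)
  rewrite exprMn (exprM s 2 4) s2 ler_wpM2r ?exprn_ge0 ?ler0n //.
  by rewrite -natrX ler_nat.
have ln_ge0n : 0 <= ln (n%:R : R) by rewrite ln_ge0 // ler1n.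
have ln_le : ln (n%:R : R) <= 16 * s.
  apply: (@le_trans _ _ (ln ((2 * s) ^+ 8))).
    by rewrite ler_ln ?posrE // exprn_gt0 // mulr_gt0.
  rewrite lnXn ?mulr_gt0 //; have := @ln_sublinear R (2 * s).
  rewrite mulr_gt0 // => /(_ isT); rewrite -[ln _ *+ 8]mulr_natr; lra.
rewrite -s2; nra.
Qed.

(** Tail infima are nondecreasing, so the lower limit is their supremum, hence at least the infimum
    over the tail from [n0], which is at least [c]. *)
Lemma limn_einf_gt0 (R : realType) (u : nat -> R) (c : R) (n0 : nat) :
  0 < c -> (forall n, (n0 <= n)%N -> c <= u n) ->
  (0 < limn_einf (fun n => (u n)%:E))%E.
Proof.
move=> c_gt0 c_le; apply: (@lt_le_trans _ _ c%:E); first by rewrite lte_fin.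
rewrite limn_einf_lim; set v := fun n => _.
have -> : limn (einfs v) = ereal_sup (range (einfs v)).
  by apply/cvg_lim => //; exact: cvg_einfs_sup.
apply: (@le_trans _ _ (einfs v n0)).
  by apply: le_ereal_inf_tmp => _ [n /= n0_le <-]; rewrite lee_fin c_le.
by apply: ereal_sup_ubound; exists n0.
Qed.

Theorem theorem7 (R : realType) :
  (0 < limn_einf (fun n : nat =>
         ((uphi (uphi n))%:R / (ln (n%:R : R) * ln (ln (n%:R : R))))%:E))%E.
Proof.
(* Past [Num.bound (expR 1)] one has $n > e$, so $\ln n > 1$ and both factors of the denominator are
   positive. The constant inverts the 256 of [ln_sqr_le_uphi_uphi]. *)
apply: (@limn_einf_gt0 R _ (256^-1) (Num.bound (expR 1 : R))) => // n n0_le.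
have e_lt_n : expR 1 < n%:R :> R.
  by rewrite (lt_le_trans (archi_boundP (expR_ge0 1))) // ler_nat.
have n_gt0 : 0 < n%:R :> R by rewrite (lt_trans (expR_gt0 1)).
have L_gt1 : 1 < ln (n%:R : R) by rewrite -[ltLHS]expRK ltr_ln ?posrE ?expR_gt0.
have L_gt0 := lt_trans ltr01 L_gt1.
have LL_gt0 := ln_gt0 L_gt1.
rewrite ltr0n in n_gt0.
rewrite ler_pdivlMr ?mulr_gt0 // ler_pdivrMl //.
(* Since $\ln \ln n < \ln n$, the denominator is at most $(\ln n)^2$. *)
apply: le_trans (ln_sqr_le_uphi_uphi R n n_gt0).
by rewrite expr2 ler_wpM2l ?ltW ?ln_sublinear.
Qed.
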